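(* Every non-commutative Krull order $S$ (in the sense of Marubayashi) in a simple Artinian ring $Q$ is a Mori order.
   Context: An order $S$ in a simple Artinian ring $Q$ is a prime Goldie ring with total quotient ring $Q$; $U(Q)$ is the group of units of $Q$. For a right $S$-submodule $I$ of $Q$ put $(S:I)_l=\{q\in Q: qI\subseteq S\}$, and for a left $S$-submodule $J$ put $(S:J)_r=\{q\in Q: Jq\subseteq S\}$; put $I^{\nu}=(S:(S:I)_l)_r$ and ${}^{\nu}J=(S:(S:J)_r)_l$. A right $S$-ideal is a right $S$-submodule $I$ of $Q$ that is regular (contains a regular element of $S$) with $uI\subseteq S$ for some $u\in U(Q)$; it is integral if $I\subseteq S$, and right divisorial if $I^{\nu}=I$. Left $S$-ideals and left divisorial left ideals are defined symmetrically. $S$ is a right (left) Mori order if it satisfies the ascending chain condition on regular integral right (left) divisorial right (left) ideals, and a Mori order if it is both right and left Mori. An overring of $S$ is a ring $R'$ with $S\subseteq R'\subseteq Q$. An overring $R'$ is essential if (1) there are a perfect right additive topology $F$ on $S$ and a perfect left additive topology $F_l$ on $S$ such that $R'$ is the ring of quotients of $S$ with respect to each of $F$ and $F_l$; and (2) $R'I=R'$ for every $I\in F$ and $JR'=R'$ for every $J\in F_l$. A non-commutative discrete valuation ring is a Noetherian local Asano order, where local means here that the Jacobson radical is the unique maximal ideal and the quotient by it is Artinian, and an order $R$ is Asano if its two-sided $R$-ideals (those that are both left and right $R$-ideals) form a group under multiplication. An order $S$ in a simple Artinian ring $Q$ is a Krull order (in the sense of Marubayashi) if there exist families $\{R_i\}_{i\in\alpha}$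 and $\{S_j\}_{j\in\beta}$ of essential overrings of $S$ such that: (K1) $S=(\bigcap_{i\in\alpha}R_i)\cap(\bigcap_{j\in\beta}S_j)$; (K2) each $R_i$ is a non-commutative discrete valuation ring, each $S_j$ is a simple Noetherian ring, and $|\beta|<\infty$; (K3) for every regular element $c\in S$, $cR_i\neq R_i$ (respectively $R_ic\neq R_i$) for only finitely many $i\in\alpha$. *)

(* Defs.v *)
From HB Require Import structures.
From mathcomp Require Import all_boot all_order all_algebra.
From mathcomp Require Import all_classical.

Set Implicit Arguments.
Unset Strict Implicit.
Unset Printing Implicit Defensive.

Import GRing.Theory.
Local Open Scope classical_set_scope.
Local Open Scope ring_scope.

(* Subrings of Q and their one-sided ideals are sets [set Q].  Left-handed
   notions are the right-handed ones in the converse ring Q^c, whose carrier is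
   convertible to that of Q: in Q^c, x * y is the product y * x of Q. *)

Section Basics.
Variable Q : unitRingType.
Implicit Types (R S I J : set Q) (P : set (set Q)).

Definition subring R : Prop :=
  [/\ R 1, (forall x y, R x -> R y -> R (x - y))
    & (forall x y, R x -> R y -> R (x * y))].

Definition right_submodule R I : Prop :=
  [/\ I 0, (forall x y, I x -> I y -> I (x - y))
    & (forall x r, I x -> R r -> I (x * r))].

Definition right_ideal R I : Prop := right_submodule R I /\ I `<=` R.

(* The additive subgroup generated by the products a * b. *)
Definition prodset (A B : set Q) : set Q :=
  [set q | exists2 s : seq (Q * Q),
     forall p, p \in s -> A p.1 /\ B p.2 & q = \sum_(p <- s) p.1 * p.2].

Definition regular_elt R (c : Q) : Prop :=
  R c /\ forall x, R x -> (c * x = 0 -> x = 0) /\ (x * c = 0 -> x = 0).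

Definition acc P : Prop :=
  forall I : nat -> set Q, (forall n, P (I n)) ->
    (forall n, I n `<=` I n.+1) -> exists m, forall n, (m <= n)%N -> I n = I m.

Definition dcc P : Prop :=
  forall I : nat -> set Q, (forall n, P (I n)) ->
    (forall n, I n.+1 `<=` I n) -> exists m, forall n, (m <= n)%N -> I n = I m.

Definition right_annihilator R (X : set Q) : set Q :=
  [set r | R r /\ forall x, X x -> x * r = 0].

(* The sum of the I n is direct. *)
Definition independent_family (I : nat -> set Q) : Prop :=
  forall n (x : 'I_n -> Q), (forall i : 'I_n, I i (x i)) ->
    \sum_(i < n) x i = 0 -> forall i, x i = 0.

Definition right_goldie R : Prop :=
  acc [set A | exists2 X, X `<=` R & A = right_annihilator R X] /\
  ~ (exists I : nat -> set Q,
       (forall n, right_ideal R (I n) /\ I n <> [set 0]) /\ independent_family I).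

Definition right_fractions S : Prop :=
  forall q : Q, exists a c, [/\ S a, regular_elt S c & q = a * c^-1].

Definition maximal P M : Prop :=
  P M /\ forall I, P I -> M `<=` I -> I = M.

Definition jacobson_radical R : set Q :=
  [set x | R x /\
     forall M, maximal [set I | right_ideal R I /\ I <> R] M -> M x].

End Basics.

Section TwoSided.
Variable Q : unitRingType.
Implicit Types (R S I J : set Q).

Definition left_submodule R I : Prop := @right_submodule Q^c R I.
Definition left_ideal R I : Prop := @right_ideal Q^c R I.
Definition left_goldie R : Prop := @right_goldie Q^c R.
Definition left_fractions S : Prop := @right_fractions Q^c S.

Definition two_sided_ideal R I : Prop := right_ideal R I /\ left_ideal R I.

Definition noetherian R : Prop := acc (right_ideal R) /\ acc (left_ideal R).

(* R / J is Artinian, for J an ideal of R: the right (left) ideals of R / J are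
   the I / J with I a right (left) ideal of R containing J. *)
Definition artinian_quotient R J : Prop :=
  dcc [set I | right_ideal R I /\ J `<=` I] /\
  dcc [set I | left_ideal R I /\ J `<=` I].

Definition artinian R : Prop := dcc (right_ideal R) /\ dcc (left_ideal R).

Definition simple_ring R : Prop :=
  forall I, two_sided_ideal R I -> I = [set 0] \/ I = R.

Definition prime_ring R : Prop :=
  forall I J, two_sided_ideal R I -> two_sided_ideal R J ->
    prodset I J `<=` [set 0] -> I `<=` [set 0] \/ J `<=` [set 0].

Definition total_quotient_ring S : Prop :=
  [/\ (forall c, regular_elt S c -> c \is a GRing.unit),
      right_fractions S & left_fractions S].

Definition order_in_Q S : Prop :=
  [/\ subring S, prime_ring S, right_goldie S, left_goldie S
    & total_quotient_ring S].

(* (S : I)_l *)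
Definition colon_l S I : set Q := [set q | forall x, I x -> S (q * x)].
(* (S : J)_r *)
Definition colon_r S J : set Q := [set q | forall x, J x -> S (x * q)].

Definition right_nu S I : set Q := colon_r S (colon_l S I).
Definition left_nu S J : set Q := colon_l S (colon_r S J).

Definition right_fractional_ideal S I : Prop :=
  [/\ right_submodule S I, (exists c, regular_elt S c /\ I c)
    & (exists2 u, u \is a GRing.unit & forall x, I x -> S (u * x))].

Definition left_fractional_ideal S J : Prop :=
  [/\ left_submodule S J, (exists c, regular_elt S c /\ J c)
    & (exists2 u, u \is a GRing.unit & forall x, J x -> S (x * u))].

Definition fractional_ideal S I : Prop :=
  right_fractional_ideal S I /\ left_fractional_ideal S I.

Definition right_divisorial S I : Prop :=
  right_fractional_ideal S I /\ right_nu S I = I.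
Definition left_divisorial S J : Prop :=
  left_fractional_ideal S J /\ left_nu S J = J.

Definition right_mori S : Prop :=
  acc [set I | right_divisorial S I /\ I `<=` S].
Definition left_mori S : Prop :=
  acc [set J | left_divisorial S J /\ J `<=` S].
Definition mori_order S : Prop := right_mori S /\ left_mori S.

Definition group_under (T : Type) (G : set T) (op : T -> T -> T) : Prop :=
  [/\ (forall x y, G x -> G y -> G (op x y)),
      (forall x y z, G x -> G y -> G z -> op x (op y z) = op (op x y) z)
    & exists e, [/\ G e, (forall x, G x -> op e x = x /\ op x e = x)
        & forall x, G x -> exists y, [/\ G y, op x y = e & op y x = e]]].

Definition asano R : Prop :=
  order_in_Q R /\ group_under (fractional_ideal R) (@prodset Q).

Definition maximal_ideal R M : Prop :=
  maximal [set I | two_sided_ideal R I /\ I <> R] M.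

Definition local_ring R : Prop :=
  [/\ maximal_ideal R (jacobson_radical R),
      (forall M, maximal_ideal R M -> M = jacobson_radical R)
    & artinian_quotient R (jacobson_radical R)].

Definition noncomm_dvr R : Prop := [/\ noetherian R, local_ring R & asano R].

End TwoSided.

Section Quotients.
Variable Q : unitRingType.
Implicit Types (S R I J : set Q) (F : set (set Q)).

(* Right additive topologies, also called right Gabriel topologies. *)
Definition right_topology S F : Prop :=
  [/\ F S /\ (forall I, F I -> right_ideal S I),
      (forall I J, F I -> right_ideal S J -> I `<=` J -> F J),
      (forall I J, F I -> F J -> F (I `&` J)),
      (forall I a, F I -> S a -> F [set s | S s /\ I (a * s)])
    & (forall I J, right_ideal S I -> F J ->
         (forall a, J a -> F [set s | S s /\ I (a * s)]) -> F I)].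

(* R is the ring of quotients lim_(I in F) Hom_S(I, S / t(S)), where t(S) is the
   F-torsion of S.  The second condition gives t(S) = 0, since S is contained in
   R, and then the three conditions say that sending q to left multiplication by
   q is a well-defined, injective, surjective map from R to
   lim_(I in F) Hom_S(I, S). *)
Definition right_quotient_ring S F R : Prop :=
  [/\ (forall q, R q -> exists2 I, F I & forall x, I x -> S (q * x)),
      (forall q I, R q -> F I -> (forall x, I x -> q * x = 0) -> q = 0)
    & (forall I (f : Q -> Q), F I ->
         (forall x, I x -> S (f x)) ->
         (forall x y, I x -> I y -> f (x + y) = f x + f y) ->
         (forall x s, I x -> S s -> f (x * s) = f x * s) ->
         exists2 q, R q & forall x, I x -> f x = q * x)].

(* f is only relevant on R. *)
Definition ring_hom_on R (T : pzRingType) (f : Q -> T) : Prop :=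
  [/\ f 1 = 1, (forall x y, R x -> R y -> f (x + y) = f x + f y)
    & (forall x y, R x -> R y -> f (x * y) = f x * f y)].

(* The inclusion of S in R is an epimorphism of rings. *)
Definition ring_epi S R : Prop :=
  forall (T : pzRingType) (f g : Q -> T),
    ring_hom_on R f -> ring_hom_on R g ->
    (forall s, S s -> f s = g s) -> forall r, R r -> f r = g r.

Definition right_module S (M : zmodType) (act : M -> Q -> M) : Prop :=
  [/\ (forall x y s, S s -> act (x + y) s = act x s + act y s),
      (forall x s t, S s -> S t -> act x (s + t) = act x s + act x t),
      (forall x s t, S s -> S t -> act x (s * t) = act (act x s) t)
    & (forall x, act x 1 = x)].

Definition balanced S R (M : zmodType) (act : M -> Q -> M)
    (A : zmodType) (beta : M -> Q -> A) : Prop :=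
  [/\ (forall x y r, R r -> beta (x + y) r = beta x r + beta y r),
      (forall x r r', R r -> R r' -> beta x (r + r') = beta x r + beta x r')
    & (forall x s r, S s -> R r -> beta (act x s) r = beta x (s * r))].

(* The sum of the x (x) r over the pairs (x, r) of t vanishes in the tensor
   product of M and R over S; by the universal property, this means that every
   balanced map kills it. *)
Definition tensor_null S R (M : zmodType) (act : M -> Q -> M)
    (t : seq (M * Q)) : Prop :=
  forall (A : zmodType) (beta : M -> Q -> A), balanced S R act beta ->
    \sum_(p <- t) beta p.1 p.2 = 0.

(* R is flat as a left S-module: tensoring with R over S preserves
   monomorphisms of right S-modules. *)
Definition left_flat S R : Prop :=
  forall (M N : zmodType) (actM : M -> Q -> M) (actN : N -> Q -> N)
         (h : {additive M -> N}),
    right_module S actM -> right_module S actN ->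
    (forall x s, S s -> h (actM x s) = actN (h x) s) -> injective h ->
    forall t : seq (M * Q), (forall p, p \in t -> R p.2) ->
      tensor_null S R actN [seq (h p.1, p.2) | p <- t] ->
      tensor_null S R actM t.

(* F is a perfect right additive topology on S with ring of quotients R: S -> R
   is a left flat epimorphism of rings and F consists of the right ideals I of S
   such that I R = R. *)
Definition perfect_right_quotient S F R : Prop :=
  [/\ right_topology S F, right_quotient_ring S F R, ring_epi S R,
      left_flat S R
    & (forall I, right_ideal S I -> (F I <-> prodset I R = R))].

End Quotients.

Section Krull.
Variable Q : unitRingType.
Implicit Types (S R : set Q) (F : set (set Q)).

Definition perfect_left_quotient S F R : Prop :=
  @perfect_right_quotient Q^c S F R.

Definition overring S R : Prop := subring R /\ S `<=` R.

Definition essential_overring S R : Prop :=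
  overring S R /\
  exists F Fl : set (set Q),
    [/\ perfect_right_quotient S F R, perfect_left_quotient S Fl R,
        (forall I, F I -> prodset R I = R)
      & (forall J, Fl J -> prodset J R = R)].

Definition krull_order S : Prop :=
  exists (alpha beta : Type) (R_ : alpha -> set Q) (S_ : beta -> set Q),
    [/\ (forall i, essential_overring S (R_ i)) /\
        (forall j, essential_overring S (S_ j)),
        S = (\bigcap_i R_ i) `&` (\bigcap_j S_ j),
        [/\ (forall i, noncomm_dvr (R_ i)),
            (forall j, simple_ring (S_ j) /\ noetherian (S_ j))
          & finite_set [set: beta]]
      & forall c, regular_elt S c ->
          finite_set [set i | [set c * r | r in R_ i] <> R_ i] /\
          finite_set [set i | [set r * c | r in R_ i] <> R_ i]].

End Krull.

(* Main.v *)
Require Import Defs.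
From mathcomp Require Import all_boot all_order all_algebra.
From mathcomp Require Import all_classical.

(** Let S be the intersection of overrings T_k that are right Noetherian and in
    each of which, up to finitely many k, a given regular element of S is
    invertible. Along an ascending chain of ideals I_n of S, the right
    T_k-submodule I_n T_k is all of T_k for almost every k, since I_0 contains a
    regular element, and it stabilises for the remaining k; hence all the
    I_n T_k are constant from a common rank on. As q I is contained in S if and
    only if q (I T_k) is contained in T_k for every k, the I T_k determine
    (S : I)_l and thus I^nu. The left-handed half is the same argument in Q^c. *)

Set Implicit Arguments.
Unset Strict Implicit.
Unset Printing Implicit Defensive.

Import GRing.Theory.
Local Open Scope classical_set_scope.
Local Open Scope ring_scope.

(** Ranks chosen one per element of [D] take finitely many values, and their maximum serves them
    all. *)
Lemma finite_set_uniform_rank (K : Type) (D : set K) (P : K -> nat -> Prop) :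
  finite_set D -> (forall k, D k -> exists m, P k m) ->
  (forall k m n, (m <= n)%N -> P k m -> P k n) ->
  exists m, forall k, D k -> P k m.
Proof.
move=> finD exP monoP.
have {exP} /choice[f Pf] k : exists m, D k -> P k m.
  by have [/exP[m Pm]|nDk] := pselect (D k); [exists m | exists 0%N].
have /finite_seqP[s fDs] := finite_image f finD.
exists (\max_(i <- s) i)%N => k Dk; apply: (monoP _ (f k)); last exact: Pf.
apply: leq_bigmax_seq => //.
have : [set` s] (f k) by rewrite -fDs; exists k.
by [].
Qed.

Section RightModules.
Variable Q : unitRingType.
Implicit Types (S T I : set Q).

(* The product I T, when T is a subring. *)
Definition extension T I : set Q := smallest (right_submodule T) I.

Lemma extension_submodule T I : right_submodule T (extension T I).
Proof.
split=> [J [[]] //|x y Ix Iy J IJ|x r Ix Tr J IJ].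
- by have [[_ subJ _] _] := IJ; apply: subJ; [apply: Ix | apply: Iy].
- by have [[_ _ mulJ] _] := IJ; apply: mulJ => //; apply: Ix.
Qed.

Lemma subring_right_ideal T : subring T -> right_ideal T T.
Proof.
by case=> T1 Tsub Tmul; split=> //; split=> //; rewrite -(subrr 1); apply: Tsub.
Qed.

Lemma extension_right_ideal T I :
  subring T -> I `<=` T -> right_ideal T (extension T I).
Proof.
move=> ringT IT; split; first exact: extension_submodule.
by apply: smallest_sub => //; case: (subring_right_ideal ringT).
Qed.

Lemma extension_full T I c : subring T -> I `<=` T -> I c ->
  [set c * r | r in T] = T -> extension T I = T.
Proof.
move=> ringT IT Ic cT; have [_ extT] := extension_right_ideal ringT IT.
apply/seteqP; split=> // x; rewrite -{1}cT => -[r Tr <-].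
have [_ _ mulE] := extension_submodule T I.
by apply: mulE => //; exact: sub_gen_smallest.
Qed.

(** For fixed [q], the [y] with [q * y] in [T] form a right [T]-submodule, which contains the
    extension of [I] once it contains [I]. *)
Lemma colon_l_extension T I : subring T ->
  colon_l T (extension T I) = colon_l T I.
Proof.
move=> [T1 Tsub Tmul]; apply/seteqP; split=> q Tq x Ix.
  by apply: Tq; exact: sub_gen_smallest.
apply: (Ix [set y | T (q * y)]); split=> //; split=> [|y z Ty Tz|y r Ty Tr] /=.
- by rewrite mulr0 -(subrr 1); apply: Tsub.
- by rewrite mulrBr; apply: Tsub.
- by rewrite mulrA; apply: Tmul.
Qed.

Lemma colon_l_bigcap (K : Type) (T : K -> set Q) I :
  colon_l (\bigcap_k T k) I = \bigcap_k colon_l (T k) I.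
Proof.
by apply/seteqP; split=> q Tq => [k _ x Ix|x Ix k _]; apply: Tq.
Qed.

(** The ambient ring is arbitrary, so that the left-handed half can be read off in [Q^c]. The
    element [c] stands for the regular element of a divisorial ideal. *)
Lemma bigcap_noetherian_right_acc (K : Type) (T : K -> set Q) :
    let S := \bigcap_k T k in
    (forall k, subring (T k)) -> (forall k, acc (right_ideal (T k))) ->
  acc [set I | [/\ I `<=` S, right_nu S I = I
    & exists2 c, I c & finite_set [set k | [set c * r | r in T k] <> T k]]].
Proof.
move=> S ringT noethT I accI incI.
have IT n k : I n `<=` T k by have [IS _ _] := accI n; move=> x /IS; apply.
have mono m n : (m <= n)%N -> I m `<=` I n.
  apply: (homo_leq (r := @subset Q)) incI m n => [A|B A C].
    exact: subset_refl.
  exact: subset_trans.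
have [_ _ [c I0c fin_c]] := accI 0%N.
pose stable k m := forall n, (m <= n)%N ->
  extension (T k) (I n) = extension (T k) (I m).
have [|k m n le_mn stab p le_np|m stab] :=
  finite_set_uniform_rank (P := stable) fin_c.
- move=> k _; apply: (noethT k (fun n => extension (T k) (I n))) => n.
    exact: extension_right_ideal.
  by apply: sub_smallest2r => //; exact: extension_submodule.
- by rewrite (stab p (leq_trans le_mn le_np)) (stab n le_mn).
exists m => n le_mn.
have extE k : extension (T k) (I n) = extension (T k) (I m).
  (* For a non-exceptional [k], the element [c] of [I 0] lies in every [I p] and already generates
     [T k]. *)
  have [cT|/stab] := pselect ([set c * r | r in T k] = T k); last exact.
  have full p : extension (T k) (I p) = T k.
    by apply: extension_full cT => //; apply: (mono 0%N).
  by rewrite !full.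
have colonE : colon_l S (I n) = colon_l S (I m).
  rewrite !colon_l_bigcap; apply: eq_bigcapr => k _.
  by rewrite -(colon_l_extension (I n) (ringT k)) extE colon_l_extension.
by have [_ <- _] := accI n; have [_ <- _] := accI m; rewrite /right_nu colonE.
Qed.

Lemma subring_converse T : subring T -> @subring Q^c T.
Proof. by case=> T1 Tsub Tmul; split=> // x y Tx Ty; apply: Tmul. Qed.

End RightModules.

Lemma acc_sub (Q : unitRingType) (P P' : set (set Q)) :
  P `<=` P' -> acc P' -> acc P.
Proof. by move=> PP' accP' I PI; apply: accP' => n; apply: PP'. Qed.

Theorem corollary3p11 (Q : unitRingType) (S : set Q)
    (simpleQ : simple_ring [set: Q]) (artinianQ : artinian [set: Q])
    (orderS : order_in_Q S) (krullS : krull_order S) :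
  mori_order S.
Proof.
have [alpha [beta [R_ [S_]]]] := krullS.
move=> [[essR essS] defS [dvrR noethS finB] finC].
pose T (k : alpha + beta) := match k with inl i => R_ i | inr j => S_ j end.
have ST : S = \bigcap_k T k.
  rewrite defS; apply/seteqP; split=> [q [Rq Sq] [i|j] _|q Tq].
  - exact: Rq.
  - exact: Sq.
  - by split=> k _; [apply: (Tq (inl k)) | apply: (Tq (inr k))].
have ringT k : subring (T k).
  by case: k => [i|j]; [have [[]] := essR i | have [[]] := essS j].
have noethT k : noetherian (T k).
  by case: k => [i|j]; [have [] := dvrR i | have [] := noethS j].
(* (K3) controls only the [R_ i]; all the [S_ j] may be exceptional, as [beta] is finite. *)
have finT (A : set alpha) (B : set (alpha + beta)) :
    finite_set A -> (forall i, B (inl i) -> A i) -> finite_set B.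
  move=> finA BA.
  apply: (@sub_finite_set _ _ (inl @` A `|` inr @` [set: beta])).
    by move=> [i /BA Ai|j _]; [left; exists i | right; exists j].
  by rewrite finite_setU; split; apply: finite_image.
split.
- have := bigcap_noetherian_right_acc ringT (fun k => (noethT k).1).
  rewrite -ST; apply: acc_sub => I [[[_ [c [/finC[fin_c _] Ic]] _] nuI] IS].
  by split=> //; exists c => //; apply: finT fin_c _.
(* In [Q^c], [right_nu] unfolds to [left_nu] and [c * r] to [r * c], so the second half of [finC]
   applies. *)
- have := @bigcap_noetherian_right_acc Q^c _ T
    (fun k => subring_converse (ringT k)) (fun k => (noethT k).2).
  rewrite -ST; apply: acc_sub => I [[[_ [c [/finC[_ fin_c] Ic]] _] nuI] IS].
  by split=> //; exists c => //; apply: finT fin_c _.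
Qed.
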